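(* Let $n$ be odd. For any antiperiodic path $(a_1,\dots,a_n,a_{n+1})$, i.e. $a_i\in\mathbb Z+\frac n2$ with $|a_i-a_{i+1}|=1$ for $i=1,\dots,n$ and $a_{n+1}=-a_1$, one has \[T_{\mathrm{IRF}}(z)\,|a_1,\dots,a_{n+1}\rangle=\sum_{b_1,\dots,b_n,\,b_{n+1}=-b_1}\ \prod_{i=1}^nW(a_{i+1},a_i,b_i,b_{i+1}\,|\,z-z_i)\ |b_1,\dots,b_{n+1}\rangle,\] where the sum is over antiperiodic paths $(b_1,\dots,b_{n+1})$.
   Context: Let $\mathrm{Im}\,\tau>0$, $\eta\in\mathbb C$ generic (so that no odd multiple of $\eta$ lies in $\mathbb Z+\tau\mathbb Z$), $z_1,\dots,z_n\in\mathbb C$, $\theta(z)=-\sum_{j\in\mathbb Z}\exp(i\pi(j+\frac12)^2\tau+2\pi i(j+\frac12)(z+\frac12))$. Let $V$ be the complex vector space with basis $e[1],e[-1]$, dual basis $e^*[1],e^*[-1]$, $E_{ij}e[k]=\delta_{jk}e[i]$, $h=E_{11}-E_{-1,-1}$, $\alpha(z,\lambda)=\frac{\theta(\lambda+2\eta)\theta(z)}{\theta(\lambda)\theta(z-2\eta)}$, $\beta(z,\lambda)=-\frac{\theta(\lambda+z)\theta(2\eta)}{\theta(\lambda)\theta(z-2\eta)}$ and \[R(z,\lambda)=E_{11}\otimes E_{11}+E_{-1,-1}\otimes E_{-1,-1}+\alpha(z,\lambda)E_{11}\otimes E_{-1,-1}+\alpha(z,-\lambda)E_{-1,-1}\otimes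 E_{11}+\beta(z,\lambda)E_{1,-1}\otimes E_{-1,1}+\beta(z,-\lambda)E_{-1,1}\otimes E_{1,-1}.\] The Boltzmann weights $W(c,b,a,d|z)$ are defined by \[R(z,\lambda=-2\eta d)\,e[c-d]\otimes e[b-c]=\sum_aW(c,b,a,d|z)\,e[b-a]\otimes e[a-d]\] for $c-d,b-c,b-a,a-d\in\{-1,1\}$, and $W(c,b,a,d|z)=0$ if these conditions are not fulfilled. On $V\otimes V^{\otimes n}$ (factors numbered $0,1,\dots,n$) put \[L(z,\lambda)=R^{(01)}\Bigl(z-z_1,\lambda-2\eta\sum_{i=2}^nh^{(i)}\Bigr)\cdots R^{(0,n-1)}(z-z_{n-1},\lambda-2\eta h^{(n)})\,R^{(0n)}(z-z_n,\lambda),\] where $h^{(i)}$ in an argument is replaced by its eigenvalue on the $i$th component of the vector acted on. Let $K\in\mathrm{End}(V)$ exchange $e[1]$ and $e[-1]$. The twisted transfer matrix acts on $V^{\otimes n}$-valued functions $u(\lambda)$ by \[(T_{\mathrm{IRF}}(z)u)(\lambda)=\sum_{\mu=\pm1}(e^*[\mu]\otimes\mathrm{Id})\,(K\otimes\mathrm{Id})\,L(z,\lambda)\bigl(e[\mu]\otimes u(\lambda-2\eta\mu)\bigr),\] restricted to functions of the form $u(\lambda)=\sum_\mu\delta_{\eta\mu}(\lambda)u[\mu]$ with $u[\mu]\in V^{\otimes n}$ of weight $\mu$ (for $\sum_ih^{(i)}$), where $\delta_a(b)=1$ if $a=b$ and $0$ otherwise. This $2^n$-dimensional space has the basis, indexed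 by antiperiodic paths, \[|a_1,\dots,a_{n+1}\rangle=\delta_{-2\eta a_{n+1}}(\lambda)\,e[a_1-a_2]\otimes\cdots\otimes e[a_n-a_{n+1}].\] *)

(* Defs.v *)
From mathcomp Require Import all_boot all_order all_algebra.
From mathcomp Require Import complex mxtens.
From mathcomp Require Import all_classical all_reals all_analysis.
Import Order.TTheory GRing.Theory Num.Theory.
Import numFieldNormedType.Exports.

Set Implicit Arguments.
Unset Strict Implicit.
Unset Printing Implicit Defensive.

Local Open Scope classical_set_scope.
Local Open Scope complex_scope.
Local Open Scope ring_scope.

Definition cexp (R : realType) (z : R[i]) : R[i] :=
  (expR (complex.Re z))%:C * (cos (complex.Im z) +i* sin (complex.Im z)).

Definition theta_term (R : realType) (tau z : R[i]) (j : int) : R[i] :=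
  cexp ('i%C * (pi : R)%:C * (j%:~R + 2^-1) ^+ 2 * tau
        + 2 * 'i%C * (pi : R)%:C * (j%:~R + 2^-1) * (z + 2^-1)).

(* The sum over all integers pairs the index k >= 0 with the index -k-1 < 0;
   for Im tau > 0 the convergence is absolute, so the order is irrelevant. The
   cast to a numFieldType gives access to the norm topology of R[i]. *)
Definition theta (R : realType) (tau z : R[i]) : R[i] :=
  - limn (fun N : nat => \sum_(0 <= k < N)
      (theta_term tau z k%:Z + theta_term tau z (- k%:Z - 1))
      : (R[i] : numFieldType)).

(* Spins are encoded by 'I_2, the indices 0 and 1 standing for +1 and -1; this
   is the eigenvalue of h on the corresponding basis vector. *)
Definition spin (R : realType) (s : 'I_2) : R[i] := if s == 0 then 1 else -1.

(* e[k] and e^*[k] are only meaningful for k = 1 or k = -1, and are zero for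
   any other k. *)
Definition evec (R : realType) (k : R[i]) : 'cV[R[i]]_2 :=
  \col_s (spin R s == k)%:R.

Definition edual (R : realType) (k : R[i]) : 'rV[R[i]]_2 :=
  \row_s (spin R s == k)%:R.

Definition Emx (R : realType) (i j : R[i]) : 'M[R[i]]_2 := evec i *m edual j.

Definition Kmx (R : realType) : 'M[R[i]]_2 := Emx 1 (-1) + Emx (-1) 1.

Definition alpha (R : realType) (tau eta z lambda : R[i]) : R[i] :=
  (theta tau (lambda + 2 * eta) * theta tau z)
  / (theta tau lambda * theta tau (z - 2 * eta)).

Definition beta (R : realType) (tau eta z lambda : R[i]) : R[i] :=
  - ((theta tau (lambda + z) * theta tau (2 * eta))
     / (theta tau lambda * theta tau (z - 2 * eta))).

Definition Rmx (R : realType) (tau eta z lambda : R[i]) : 'M[R[i]]_(2 * 2) :=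
  Emx 1 1 *t Emx 1 1 + Emx (-1) (-1) *t Emx (-1) (-1)
  + alpha tau eta z lambda *: (Emx 1 1 *t Emx (-1) (-1))
  + alpha tau eta z (- lambda) *: (Emx (-1) (-1) *t Emx 1 1)
  + beta tau eta z lambda *: (Emx 1 (-1) *t Emx (-1) 1)
  + beta tau eta z (- lambda) *: (Emx (-1) 1 *t Emx 1 (-1)).

Definition is_pm1 (R : realType) (k : R[i]) : bool := (k == 1) || (k == -1).

(* For c - d and b - c in {1, -1}, W c b a d z is defined by
     R(z, -2 eta d) e[c-d] (x) e[b-c] = \sum_a W c b a d z e[b-a] (x) e[a-d],
   so it is a coordinate of the left-hand side on the tensor product basis. *)
Definition W (R : realType) (tau eta c b a d z : R[i]) : R[i] :=
  if [&& is_pm1 (c - d), is_pm1 (b - c), is_pm1 (b - a) & is_pm1 (a - d)]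
  then ((edual (b - a) *t edual (a - d))
        *m (Rmx tau eta z (- 2 * eta * d) *m (evec (c - d) *t evec (b - c)))) 0 0
  else 0.

(* V^{(x) n}, resp. V (x) V^{(x) n} with its factor 0 kept apart, in coordinates
   on the tensor product basis; the site i, with 1 <= i <= n, is the ordinal i - 1.
   The scalars are R[i]^o because R[i] itself is canonically an R-module. *)
Notation tens R n := {ffun {ffun 'I_n -> 'I_2} -> R[i]^o}.

Notation aux_tens R n := {ffun 'I_2 * {ffun 'I_n -> 'I_2} -> R[i]^o}.

Definition pure_tens (R : realType) (n : nat) (v : 'I_n -> 'cV[R[i]]_2) :
  tens R n := [ffun s : {ffun 'I_n -> 'I_2} => \prod_(i < n) v i (s i) 0].

Definition aux_pure (R : realType) (n : nat) (v : 'cV[R[i]]_2) (u : tens R n) :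
  aux_tens R n := [ffun x : 'I_2 * {ffun 'I_n -> 'I_2} => v x.1 0 * u x.2].

Definition aux_basis (R : realType) (n : nat) (x : 'I_2 * {ffun 'I_n -> 'I_2}) :
  aux_tens R n := [ffun y => (y == x)%:R].

(* A (x) Id, for A acting on the factor 0. *)
Definition aux_mx (R : realType) (n : nat) (A : 'M[R[i]]_2)
    (v : aux_tens R n) : aux_tens R n :=
  [ffun x : 'I_2 * {ffun 'I_n -> 'I_2} => \sum_(p < 2) A x.1 p * v (p, x.2)].

(* f (x) Id, for a linear form f on the factor 0. *)
Definition aux_form (R : realType) (n : nat) (f : 'rV[R[i]]_2)
    (v : aux_tens R n) : tens R n :=
  [ffun s : {ffun 'I_n -> 'I_2} => \sum_(p < 2) f 0 p * v (p, s)].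

Definition set_site (n : nat) (s : {ffun 'I_n -> 'I_2}) (i : 'I_n) (q : 'I_2) :
  {ffun 'I_n -> 'I_2} := [ffun k => if k == i then q else s k].

(* R^{(0i)}(z - z_i, lambda - 2 eta sum_{k > i} h^{(k)}), extended linearly from
   its values on the basis vectors, where h^{(k)} is the k-th spin. *)
Definition R_site (R : realType) (tau eta : R[i]) (n : nat) (zs : 'I_n -> R[i])
    (z lambda : R[i]) (i : 'I_n) (v : aux_tens R n) : aux_tens R n :=
  \sum_(x : 'I_2 * {ffun 'I_n -> 'I_2}) v x *:
    \sum_(y : 'I_2 * 'I_2)
      Rmx tau eta (z - zs i)
          (lambda - 2 * eta * \sum_(k < n | (i < k)%N) spin R (x.2 k))
          (mxtens_index y) (mxtens_index (x.1, x.2 i))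
      *: aux_basis R (y.1, set_site x.2 i y.2).

(* The factor of the last site acts first. *)
Definition Lop (R : realType) (tau eta : R[i]) (n : nat) (zs : 'I_n -> R[i])
    (z lambda : R[i]) : aux_tens R n -> aux_tens R n :=
  \big[(fun f g => f \o g)/id]_(i < n) R_site tau eta zs z lambda i.

Definition T_IRF (R : realType) (tau eta : R[i]) (n : nat) (zs : 'I_n -> R[i])
    (z : R[i]) (u : R[i] -> tens R n) : R[i] -> tens R n :=
  fun lambda => \sum_(mu <- [:: 1; -1])
    aux_form (edual mu) (aux_mx (Kmx R)
      (Lop tau eta zs z lambda (aux_pure (evec mu) (u (lambda - 2 * eta * mu))))).

Definition delta (R : realType) (a b : R[i]) : R[i] := (a == b)%:R.

(* A sequence (a_1, ..., a_{n+1}) is indexed by 'I_n.+1; for i : 'I_n the heights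
   cur a i and nxt a i are its entries at the positions i and i + 1. *)
Definition cur (R : realType) (n : nat) (a : {ffun 'I_n.+1 -> R[i]}) (i : 'I_n) :
  R[i] := a (widen_ord (leqnSn n) i).

Definition nxt (R : realType) (n : nat) (a : {ffun 'I_n.+1 -> R[i]}) (i : 'I_n) :
  R[i] := a (lift ord0 i).

Definition antiperiodic (R : realType) (n : nat) (a : {ffun 'I_n.+1 -> R[i]}) :
  Prop :=
  [/\ forall i : 'I_n.+1, exists k : int, a i = k%:~R + n%:R / 2,
      forall i : 'I_n, `|cur a i - nxt a i| = 1
    & a ord_max = - a ord0].

Definition ket (R : realType) (eta : R[i]) (n : nat)
    (a : {ffun 'I_n.+1 -> R[i]}) : R[i] -> tens R n :=
  fun lambda => delta (- 2 * eta * a ord_max) lambda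
    *: pure_tens (fun i : 'I_n => evec (cur a i - nxt a i)).

(* Main.v *)
Require Import Defs.
From mathcomp Require Import all_boot all_order all_algebra.
From mathcomp Require Import complex mxtens.
From mathcomp Require Import all_classical all_reals all_analysis.
From mathcomp Require Import ring.
Import Order.TTheory GRing.Theory Num.Theory.
Local Open Scope classical_set_scope.
Local Open Scope complex_scope.
Local Open Scope ring_scope.

(** The identity is the vertex-face correspondence, checked coordinate by
    coordinate.  Since [eta] is nonzero, every [lambda] is [- 2 * eta * d] for
    exactly one [d].  Taking [d] as last height, a spin configuration [s] of the
    sites determines all heights [height s d m] of an output path, by summing
    spins from the right.  The shift of the dynamical
    parameter in the factor acting on site [i], read on an output
    configuration, turns [- 2 * eta * d] into [- 2 * eta * height s d i.+1],
    the value used to define the weight of the face at [i].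

    Let the input be the configuration [t] with last height [c].  The matrix [R]
    conserves the total spin of the two factors it acts on ([Rmx_ice]).  Hence,
    once [t] and [s] are fixed, the auxiliary spin between two sites is forced
    to be the height difference of the two paths there, and one step of the
    monodromy matrix multiplies the coordinate by a single Boltzmann weight
    ([vertex_face]).  Induction from the last site to the first gives every
    coordinate of the monodromy matrix as a product of weights
    ([Lop_from_coord]).

    It remains to close the auxiliary line.  The auxiliary spin enters as
    [c - d] and leaves as the difference of the first heights; the twist by [K]
    requires these to be opposite.  As [c] is the last height of an antiperiodic
    path, this says exactly that [d] is the last height of the antiperiodic path
    with steps [s].  Antiperiodic paths correspond bijectively to spin
    configurations ([antiperiodic_path_of], [path_of_inj]), because
    [a_{n+1} = - a_1] makes [a_{n+1}] minus half the sum of the steps; so the sum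
    over paths is a sum over [s], whose terms have disjoint supports. *)

(** * Spins *)

Lemma ord2P (s : 'I_2) : s = ord0 \/ s = lift ord0 ord0.
Proof. by case: (unliftP ord0 s) => [j|] ->; [rewrite (ord1 j); right | left]. Qed.

Lemma spin0 (R : realType) : spin R ord0 = 1.
Proof. by []. Qed.

Lemma spin1 (R : realType) : spin R (lift ord0 ord0) = -1.
Proof. by []. Qed.

Lemma one_eqN1F (R : realType) : (((1 : R[i]) == -1) = false) * ((-1 == 1 :> R[i]) = false).
Proof.
have h : ((1 : R[i]) == -1) = false by rewrite -addr_eq0 -(natrD _ 1 1) pnatr_eq0.
by split => //; rewrite eq_sym.
Qed.

Definition spinE (R : realType) := (spin0 R, spin1 R, @eqxx R[i], one_eqN1F R).

Lemma spin_inj (R : realType) : injective (spin R).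
Proof.
by move=> s t /eqP; case: (ord2P s) => ->; case: (ord2P t) => ->;
  rewrite ?spinE.
Qed.

Lemma is_pm1_spin (R : realType) (s : 'I_2) : is_pm1 (spin R s).
Proof.
by rewrite /is_pm1; case: (ord2P s) => ->; rewrite ?spin0 ?spin1 eqxx ?orbT.
Qed.

Lemma is_pm1P (R : realType) (k : R[i]) :
  reflect (exists s, k = spin R s) (is_pm1 k).
Proof.
apply: (iffP idP) => [/orP[]/eqP ->|[s ->]]; last exact: is_pm1_spin.
  by exists ord0.
by exists (lift ord0 ord0).
Qed.

Lemma spin_rev_ord (R : realType) (s : 'I_2) : spin R (rev_ord s) = - spin R s.
Proof. by case: (ord2P s) => ->; rewrite ?spin0 ?spin1 ?opprK. Qed.

(** * The vertex and the Boltzmann weight *)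

Lemma evecE (R : realType) (k : R[i]) s j : evec k s j = (spin R s == k)%:R.
Proof. by rewrite mxE. Qed.

Lemma edualE (R : realType) (k : R[i]) s j : edual k j s = (spin R s == k)%:R.
Proof. by rewrite mxE. Qed.

Lemma EmxE (R : realType) (k l : R[i]) s t :
  Emx k l s t = (spin R s == k)%:R * (spin R t == l)%:R.
Proof. by rewrite mxE big_ord1 evecE edualE. Qed.

Lemma evec_spin (R : realType) (q s : 'I_2) j : evec (spin R q) s j = (s == q)%:R.
Proof. by rewrite evecE (inj_eq (@spin_inj R)). Qed.

Lemma edual_spin (R : realType) (q s : 'I_2) j :
  edual (spin R q) j s = (s == q)%:R.
Proof. by rewrite edualE (inj_eq (@spin_inj R)). Qed.

Lemma KmxE (R : realType) p q : Kmx R p q = (q == rev_ord p)%:R.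
Proof.
rewrite /Kmx [LHS]mxE !EmxE; case: (ord2P p) => ->; case: (ord2P q) => ->.
all: by rewrite ?spinE ?mulr0 ?mul0r ?mulr1 ?addr0 ?add0r.
Qed.

(** Each elementary term of [R] either keeps both spins or exchanges opposite
    ones, hence conserves their sum. *)
Lemma Emx_ice (R : realType) (k k' l l' : R[i]) (q s p t : 'I_2) :
  k + k' = l + l' -> spin R q + spin R s != spin R p + spin R t ->
  (Emx k l *t Emx k' l') (mxtens_index (q, s)) (mxtens_index (p, t)) = 0.
Proof.
move=> kl; rewrite tensmxE !EmxE.
case: (spin R q =P k) => [->|_]; last by rewrite !mul0r.
case: (spin R p =P l) => [->|_]; last by rewrite mulr0 mul0r.
case: (spin R s =P k') => [->|_]; last by rewrite mul0r mulr0.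
case: (spin R t =P l') => [->|_]; last by rewrite !mulr0.
by rewrite kl eqxx.
Qed.

Lemma Rmx_ice (R : realType) (tau eta z lambda : R[i]) (q s p t : 'I_2) :
  spin R q + spin R s != spin R p + spin R t ->
  Rmx tau eta z lambda (mxtens_index (q, s)) (mxtens_index (p, t)) = 0.
Proof.
move=> ne; rewrite /Rmx; set x := mxtens_index (q, s); set y := mxtens_index (p, t).
have D0 (A B : 'M[R[i]]_(2 * 2)) : A x y = 0 -> B x y = 0 -> (A + B) x y = 0.
  by move=> A0 B0; rewrite mxE A0 B0 addr0.
have Z0 k (A : 'M[R[i]]_(2 * 2)) : A x y = 0 -> (k *: A) x y = 0.
  by move=> A0; rewrite mxE A0 mulr0.
have cross : 1 + -1 = -1 + 1 :> R[i] by rewrite addrC.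
apply: (D0 _ _ _ (Z0 _ _ (Emx_ice _ _ _ _ _ _ _ _ _ (esym cross) ne))).
apply: (D0 _ _ _ (Z0 _ _ (Emx_ice _ _ _ _ _ _ _ _ _ cross ne))).
apply: (D0 _ _ _ (Z0 _ _ (Emx_ice _ _ _ _ _ _ _ _ _ erefl ne))).
apply: (D0 _ _ _ (Z0 _ _ (Emx_ice _ _ _ _ _ _ _ _ _ erefl ne))).
exact: (D0 _ _ (Emx_ice _ _ _ _ _ _ _ _ _ erefl ne) (Emx_ice _ _ _ _ _ _ _ _ _ erefl ne)).
Qed.

Lemma evec_tens (R : realType) (p t : 'I_2) :
  evec (spin R p) *t evec (spin R t) = delta_mx (mxtens_index (p, t)) 0.
Proof.
apply/matrixP => x y; case: (mxtens_indexP x) => p' t'; case: (mxtens_indexP y) => k l.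
rewrite tensmxE !evec_spin mxE (can_eq (@mxtens_indexK _ _)) xpair_eqE.
by rewrite [_ == 0](_ : _ = true) ?andbT -?natrM ?mulnb //; apply/eqP; exact: ord1.
Qed.

Lemma edual_tens (R : realType) (q s : 'I_2) :
  edual (spin R q) *t edual (spin R s) = delta_mx 0 (mxtens_index (q, s)).
Proof.
apply/matrixP => x y; case: (mxtens_indexP x) => k l; case: (mxtens_indexP y) => q' s'.
rewrite tensmxE !edual_spin mxE (can_eq (@mxtens_indexK _ _)) xpair_eqE.
by rewrite [_ == 0](_ : _ = true) -?natrM ?mulnb //; apply/eqP; exact: ord1.
Qed.

Lemma W_Rmx (R : realType) (tau eta z c b a d : R[i]) (q s p t : 'I_2) :
  c - d = spin R p -> b - c = spin R t -> b - a = spin R q -> a - d = spin R s ->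
  W tau eta c b a d z =
  Rmx tau eta z (- 2 * eta * d) (mxtens_index (q, s)) (mxtens_index (p, t)).
Proof.
move=> hp ht hq hs; rewrite /W hp ht hq hs !is_pm1_spin /= evec_tens edual_tens.
by rewrite -rowE mxE -colE mxE.
Qed.

(** This kills the configurations for which no auxiliary spin equals the height
    difference. *)
Lemma W_eq0 (R : realType) (tau eta c b a d z : R[i]) :
  ~~ is_pm1 (c - d) -> W tau eta c b a d z = 0.
Proof. by rewrite /W => /negbTE ->. Qed.

(** The local vertex-face correspondence.  [c] and [d] are the heights of the
    input and output paths to the right of a site, so the incoming auxiliary spin
    is [c - d]; spin conservation makes the outgoing one the height difference to
    the left of the site.  When [c - d] is not a spin both sides vanish, which
    is why the sum ranges over all [p] instead of assuming [c - d = spin p]. *)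
Lemma vertex_face (R : realType) (tau eta z c d : R[i]) (q s t : 'I_2) :
  \sum_(p < 2) (spin R p == c - d)%:R *
    Rmx tau eta z (- 2 * eta * d) (mxtens_index (q, s)) (mxtens_index (p, t))
  = (spin R q == c + spin R t - (d + spin R s))%:R
    * W tau eta c (c + spin R t) (d + spin R s) d z.
Proof.
case: (is_pm1P _ (c - d)) => [[p hp]|/(introN (is_pm1P _ _)) hcd]; last first.
  rewrite W_eq0 // mulr0 big1 // => p _.
  by case: eqP => [hp|_]; [rewrite -hp is_pm1_spin in hcd | rewrite mul0r].
rewrite (bigD1 p) //= hp eqxx mul1r big1 ?addr0; last first.
  by move=> p' ne; rewrite (inj_eq (@spin_inj R)) (negbTE ne) mul0r.
have -> : c + spin R t - (d + spin R s) = spin R p + spin R t - spin R s.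
  by rewrite -hp; ring.
case: (spin R q =P _) => [hq|/eqP hq]; last first.
  rewrite mul0r Rmx_ice //; apply: contra hq => /eqP h.
  by rewrite -h addrK.
rewrite mul1r -(@W_Rmx R tau eta z c (c + spin R t) (d + spin R s) d q s p t) //.
- by rewrite addrC addKr.
- by rewrite hq -hp; ring.
- by rewrite addrC addKr.
Qed.

(** * The monodromy matrix *)

(** An output configuration [s] receives contributions only from the inputs that
    agree with it off site [i].  The kernel [M] may depend on the spins of the
    other sites, as the dynamical parameter does. *)
Lemma site_kernel_coord (R : realType) (n : nat) (i : 'I_n)
    (M : {ffun 'I_n -> 'I_2} -> 'I_2 * 'I_2 -> 'I_2 * 'I_2 -> R[i])
    (v : aux_tens R n) (q : 'I_2) (s : {ffun 'I_n -> 'I_2}) :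
  (forall u t, M (set_site u i t) = M u) ->
  (\sum_(x : 'I_2 * {ffun 'I_n -> 'I_2}) v x *: \sum_(y : 'I_2 * 'I_2)
      M x.2 y (x.1, x.2 i) *: aux_basis R (y.1, set_site x.2 i y.2)) (q, s) =
  \sum_(p < 2) \sum_(t < 2) v (p, set_site s i t) * M s (q, s i) (p, t).
Proof.
move=> Mi.
have scaleo (a : R[i]) (b : R[i]^o) : a *: b = a * b by [].
have entry x : (v x *: \sum_(y : 'I_2 * 'I_2) M x.2 y (x.1, x.2 i)
      *: aux_basis R (y.1, set_site x.2 i y.2) : aux_tens R n) (q, s)
    = if x.2 == set_site s i (x.2 i) then v x * M s (q, s i) (x.1, x.2 i) else 0.
  rewrite ffunE sum_ffunE (bigD1 (q, s i)) //= big1 ?addr0 => [|y ne]; last first.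
    rewrite !ffunE; case: eqP => [[e1 e2]|_]; last exact: mulr0.
    case/eqP: ne; rewrite [y]surjective_pairing e1; congr (_, _).
    by rewrite e2 ffunE eqxx.
  rewrite !ffunE !scaleo.
  case: (x.2 =P _) => [e|ne].
    have -> : (q, s) == (q, set_site x.2 i (s i)).
      rewrite xpair_eqE eqxx /=; apply/eqP/ffunP => k; rewrite ffunE e ffunE.
      by case: (k =P i) => [->|].
    by rewrite mulr1 {1}e Mi.
  case: eqP => [[e]|_]; last by rewrite !mulr0.
  case: ne; apply/ffunP => k; rewrite ffunE e ffunE.
  by case: (k =P i) => [->|].
rewrite sum_ffunE (eq_bigr _ (fun x _ => entry x)) -big_mkcond /=.
rewrite pair_big /= (reindex_onto (fun y => (y.1, set_site s i y.2))
  (fun x => (x.1, x.2 i))) /=.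
  apply: eq_big => [[p t]|[p t] _] /=; rewrite ?ffunE eqxx ?eqxx //.
by case=> p u /= /eqP e; rewrite -e.
Qed.

Lemma R_site_coord (R : realType) (tau eta : R[i]) (n : nat) (zs : 'I_n -> R[i])
    (z lambda : R[i]) (i : 'I_n) (v : aux_tens R n) q s :
  R_site tau eta zs z lambda i v (q, s) =
  \sum_(p < 2) \sum_(t < 2) v (p, set_site s i t) *
    Rmx tau eta (z - zs i)
      (lambda - 2 * eta * \sum_(k < n | (i < k)%N) spin R (s k))
      (mxtens_index (q, s i)) (mxtens_index (p, t)).
Proof.
pose M (u : {ffun 'I_n -> 'I_2}) y x := Rmx tau eta (z - zs i)
  (lambda - 2 * eta * \sum_(k < n | (i < k)%N) spin R (u k))
  (mxtens_index y) (mxtens_index x).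
apply: (@site_kernel_coord R n i M) => u t.
rewrite /M (_ : \sum_(k < n | (i < k)%N) spin R (set_site u i t k) =
                \sum_(k < n | (i < k)%N) spin R (u k)) //.
by apply: eq_bigr => k; rewrite ffunE; case: eqP => // ->; rewrite ltnn.
Qed.

(** The path with steps [s] and last height [d], indexed from 0; [height s d n]
    is the last height. *)
Definition height (R : realType) (n : nat) (s : {ffun 'I_n -> 'I_2}) (d : R[i])
  (m : nat) : R[i] := d + \sum_(k < n | (m <= k)%N) spin R (s k).
Arguments height {R n}.

Lemma heightS (R : realType) (n : nat) (s : {ffun 'I_n -> 'I_2}) (d : R[i]) (i : 'I_n) :
  height s d i = height s d i.+1 + spin R (s i).
Proof.
rewrite /height -addrA; congr (_ + _).
rewrite (bigD1 i) //= addrC; congr (_ + _); apply: eq_bigl => k.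
by rewrite [RHS]ltn_neqAle andbC (eq_sym k).
Qed.

Lemma height_last (R : realType) (n : nat) (s : {ffun 'I_n -> 'I_2}) (d : R[i]) :
  height s d n = d.
Proof. by rewrite /height big_pred0 ?addr0 // => k; rewrite leqNgt ltn_ord. Qed.

Lemma height_set_site (R : realType) (n : nat) (s : {ffun 'I_n -> 'I_2}) (d : R[i])
    (i : 'I_n) t m : (i < m)%N -> height (set_site s i t) d m = height s d m.
Proof.
move=> im; congr (_ + _); apply: eq_bigr => k mk; rewrite ffunE.
by case: eqP => // ki; move: mk; rewrite ki leqNgt im.
Qed.

(** The product of the factors of the sites from [m] on, so that the induction
    can run from the last site, whose factor acts first, to the first. *)
Definition Lop_from (R : realType) (tau eta : R[i]) (n : nat) (zs : 'I_n -> R[i])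
    (z lambda : R[i]) (m : nat) : aux_tens R n -> aux_tens R n :=
  foldr (fun i f => R_site tau eta zs z lambda i \o f) id (drop m (enum 'I_n)).
Arguments Lop_from {R} tau eta {n}.

Lemma Lop_fromE (R : realType) (tau eta : R[i]) (n : nat) (zs : 'I_n -> R[i])
    (z lambda : R[i]) :
  Lop tau eta zs z lambda = Lop_from tau eta zs z lambda 0.
Proof.
rewrite /Lop /Lop_from drop0 enumT unlock [index_enum _]unlock.
by [].
Qed.

Lemma Lop_fromS (R : realType) (tau eta : R[i]) (n : nat) (zs : 'I_n -> R[i])
    (z lambda : R[i]) (i : 'I_n) v :
  Lop_from tau eta zs z lambda i v =
  R_site tau eta zs z lambda i (Lop_from tau eta zs z lambda i.+1 v).
Proof.
have e : drop i (enum 'I_n) = i :: drop i.+1 (enum 'I_n).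
  by rewrite (drop_nth i) ?size_enum_ord // nth_ord_enum.
rewrite /Lop_from e; exact: erefl.
Qed.

Lemma Lop_from_last (R : realType) (tau eta : R[i]) (n : nat) (zs : 'I_n -> R[i])
    (z lambda : R[i]) v :
  Lop_from tau eta zs z lambda n v = v.
Proof. by rewrite /Lop_from drop_oversize // size_enum_ord. Qed.

Definition face (R : realType) (tau eta : R[i]) (n : nat)
    (t s : {ffun 'I_n -> 'I_2}) (c d : R[i]) (k : nat) (z : R[i]) : R[i] :=
  W tau eta (height t c k.+1) (height t c k) (height s d k)
    (height s d k.+1) z.
Arguments face {R} tau eta {n}.

(** After the factors from site [m] on have acted, the sites before [m] still
    carry the input spins, and the auxiliary spin is the height difference at
    [m].  The vector [v] is the input with auxiliary spin [c - d], up to the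
    scalar [w]; describing it by its coordinates allows [c - d] not to be a
    spin, in which case [v] is zero. *)
Lemma Lop_from_coord (R : realType) (tau eta : R[i]) (n : nat) (zs : 'I_n -> R[i])
    (z c d w : R[i]) (t : {ffun 'I_n -> 'I_2}) (v : aux_tens R n) (m : nat) :
  (forall q s, v (q, s) = (s == t)%:R * (spin R q == c - d)%:R * w) ->
  (m <= n)%N ->
  forall q s, Lop_from tau eta zs z (- 2 * eta * d) m v (q, s) =
    [forall k : 'I_n, (k < m)%N ==> (s k == t k)]%:R
    * (spin R q == height t c m - height s d m)%:R
    * (\prod_(k < n | (m <= k)%N) face tau eta t s c d k (z - zs k)) * w.
Proof.
move=> hv /subnKC; move: (n - m)%N => j.
elim: j m => [|j IH] m mjn q s.
  rewrite addn0 in mjn; rewrite mjn Lop_from_last hv !height_last big_pred0; last first.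
    by move=> k; rewrite leqNgt ltn_ord.
  rewrite mulr1; congr (_%:R * _ * _); congr nat_of_bool.
  apply/eqP/forallP => [-> k|h]; first by rewrite eqxx implybT.
  by apply/ffunP => k; apply/eqP; move: (h k); rewrite ltn_ord.
have mn : (m < n)%N by rewrite -mjn addnS ltnS leq_addr.
have := IH m.+1; rewrite addSnnS => /(_ mjn) {}IH.
pose i := Ordinal mn; rewrite -[m]/(nat_of_ord i) in IH *; clearbody i => {m mjn mn}.
rewrite Lop_fromS R_site_coord.
(* The dynamical shift, read on the output spins, is the height right of site i. *)
have lam : - 2 * eta * d - 2 * eta * \sum_(k < n | (i < k)%N) spin R (s k) =
    - 2 * eta * height s d i.+1 by rewrite /height; ring.
rewrite lam.
have agreeS r : [forall k : 'I_n, (k < i.+1)%N ==> (set_site s i r k == t k)]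
    = (r == t i) && [forall k : 'I_n, (k < i)%N ==> (s k == t k)].
  apply/forallP/andP => [h|[/eqP ri /forallP h] k].
    split; first by move: (h i); rewrite ffunE ltnSn eqxx.
    apply/forallP => k; apply/implyP => ki; move: (h k).
    by rewrite ffunE (ltn_trans ki) // (negbTE (_ : k != i)) // neq_ltn ki.
  rewrite ffunE ltnS; case: (k =P i) => [->|/eqP ki]; first by rewrite ri eqxx implybT.
  by move: (h k); rewrite ltn_neqAle ki.
set P := \prod_(k < n | (i < k)%N) face tau eta t s c d k (z - zs k).
have prodS r : \prod_(k < n | (i < k)%N) face tau eta t (set_site s i r) c d k (z - zs k) = P.
  apply: eq_bigr => k ik; rewrite /face !height_set_site //; exact: ltnW.
set A := [forall k : 'I_n, _]%:R.
(* Only the input spin [t i] of site [i] survives. *)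
have inner (p : 'I_2) : \sum_(r < 2)
    Lop_from tau eta zs z (- 2 * eta * d) i.+1 v (p, set_site s i r) *
    Rmx tau eta (z - zs i) (- 2 * eta * height s d i.+1)
      (mxtens_index (q, s i)) (mxtens_index (p, r)) =
    A * P * w * ((spin R p == height t c i.+1 - height s d i.+1)%:R *
    Rmx tau eta (z - zs i) (- 2 * eta * height s d i.+1)
      (mxtens_index (q, s i)) (mxtens_index (p, t i))).
  rewrite (bigD1 (t i)) //= big1 ?addr0 => [|r rt]; last first.
    by rewrite IH agreeS (negbTE rt) !mul0r.
  rewrite IH agreeS eqxx prodS height_set_site // -/A.
  set X := Rmx _ _ _ _ _ _.
  by ring.
rewrite (eq_bigr _ (fun p _ => inner p)) -big_distrr /= vertex_face -!heightS.
rewrite (bigD1 i) //= (_ : \prod_(k < n | _ && _) _ = P); last first.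
  by apply: eq_bigl => k; rewrite ltn_neqAle andbC (eq_sym k).
rewrite /face; set X := W _ _ _ _ _ _ _.
by ring.
Qed.

Lemma Lop_coord (R : realType) (tau eta : R[i]) (n : nat) (zs : 'I_n -> R[i])
    (z c d w : R[i]) (t : {ffun 'I_n -> 'I_2}) (v : aux_tens R n) :
  (forall q s, v (q, s) = (s == t)%:R * (spin R q == c - d)%:R * w) ->
  forall q s, Lop tau eta zs z (- 2 * eta * d) v (q, s) =
    (spin R q == height t c 0 - height s d 0)%:R
    * (\prod_(k < n) face tau eta t s c d k (z - zs k)) * w.
Proof.
move=> hv q s; rewrite Lop_fromE (@Lop_from_coord _ _ _ _ _ _ c d w t) //.
by rewrite (_ : [forall k : 'I_n, _]) ?mul1r //; apply/forallP.
Qed.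

(** * Antiperiodic paths *)

(** The only last height for which the path with steps [s] is antiperiodic. *)
Definition closing_height (R : realType) (n : nat) (s : {ffun 'I_n -> 'I_2}) : R[i] :=
  - (\sum_k spin R (s k)) / 2.
Arguments closing_height R {n}.

Definition path_of (R : realType) (n : nat) (s : {ffun 'I_n -> 'I_2}) :
  {ffun 'I_n.+1 -> R[i]} := [ffun i : 'I_n.+1 => height s (closing_height R s) i].
Arguments path_of R {n}.

Lemma cur_path_of (R : realType) (n : nat) (s : {ffun 'I_n -> 'I_2}) (i : 'I_n) :
  cur (path_of R s) i = height s (closing_height R s) i.
Proof. by rewrite /cur ffunE. Qed.

Lemma nxt_path_of (R : realType) (n : nat) (s : {ffun 'I_n -> 'I_2}) (i : 'I_n) :
  nxt (path_of R s) i = height s (closing_height R s) i.+1.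
Proof. by rewrite /nxt ffunE. Qed.

Lemma path_of_step (R : realType) (n : nat) (s : {ffun 'I_n -> 'I_2}) (i : 'I_n) :
  cur (path_of R s) i - nxt (path_of R s) i = spin R (s i).
Proof. by rewrite cur_path_of nxt_path_of heightS addrC addKr. Qed.

Lemma path_of_inj (R : realType) (n : nat) : injective (@path_of R n).
Proof.
by move=> s t e; apply/ffunP => i; apply: (@spin_inj R); rewrite -!path_of_step e.
Qed.

Lemma path_of_last (R : realType) (n : nat) (s : {ffun 'I_n -> 'I_2}) :
  path_of R s ord_max = closing_height R s.
Proof. by rewrite ffunE height_last. Qed.

Lemma path_of_antiperiodic (R : realType) (n : nat) (s : {ffun 'I_n -> 'I_2}) :
  antiperiodic (path_of R s).
Proof.
split=> [i|i|].
- have spinZ (u : 'I_2) : exists k : int, spin R u = 2 * k%:~R - 1.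
    case: (ord2P u) => ->; rewrite ?spin0 ?spin1; [exists 1|exists 0]; ring.
  (* A sum of [n] signs has the parity of [n], so its half lies in [Z + n/2]. *)
  have shift : exists k : int, \sum_k spin R (s k) = 2 * k%:~R - n%:R.
    elim: n s {i} => [|n IH] s; first by exists 0; rewrite big_ord0; ring.
    have [k e] := IH [ffun i => s (lift ord0 i)]; have [l e'] := spinZ (s ord0).
    exists (l + k); rewrite big_ord_recl e'.
    have -> : \sum_(i < n) spin R (s (lift ord0 i)) = 2 * k%:~R - n%:R.
      by rewrite -e; apply: eq_bigr => i _; rewrite ffunE.
    by rewrite -natr1 intrD; ring.
  have partial : exists k : int, \sum_(k < n | (i <= k)%N) spin R (s k) = k%:~R.
    elim/big_ind: _ => [|x y [k ->] [l ->]|k _]; first by exists 0.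
      by exists (k + l); rewrite intrD.
    by have [l ->] := spinZ (s k); exists (2 * l - 1); rewrite intrB intrM.
  have [k ek] := shift; have [l el] := partial; exists (l - k).
  by rewrite ffunE /height /closing_height ek el intrB; field.
- rewrite path_of_step; case: (ord2P (s i)) => ->;
  by rewrite ?spin0 ?spin1 ?normrN normr1.
- by rewrite path_of_last !ffunE /height /closing_height; field.
Qed.

Lemma antiperiodic_path_of (R : realType) (n : nat) (a : {ffun 'I_n.+1 -> R[i]}) :
  antiperiodic a -> exists s, a = path_of R s.
Proof.
case=> aZ step anti.
have stepP (i : 'I_n) : exists s, cur a i - nxt a i = spin R s.
  apply/is_pm1P; move: (step i); rewrite /cur /nxt.
  have [k ->] := aZ (widen_ord (leqnSn n) i); have [l ->] := aZ (lift ord0 i).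
  rewrite opprD addrACA subrr addr0 -intrB -intr_norm => /eqP.
  rewrite -[1]/(1%:~R) eqr_int eqr_norml ler01 andbT /is_pm1.
  by case/orP => /eqP ->; rewrite ?rmorphN eqxx ?orbT.
have [f fP] := choice stepP.
pose s : {ffun 'I_n -> 'I_2} := [ffun i => f i]; exists s.
(* Heights are recovered from the steps by descending induction. *)
have aE (m : nat) (mn : (m <= n)%N) : a (inord m) = height s (a ord_max) m.
  move: mn => /subnKC; move: (n - m)%N => j; elim: j m => [|j IH] m mjn.
    rewrite addn0 in mjn; rewrite mjn height_last; congr (a _).
    by apply/val_inj; rewrite /= inordK.
  have mn : (m < n)%N by rewrite -mjn addnS ltnS leq_addr.
  have := fP (Ordinal mn); rewrite /cur /nxt.
  rewrite (_ : widen_ord _ _ = inord m); last by apply/val_inj; rewrite /= inordK // ltnS ltnW.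
  rewrite (_ : lift _ _ = inord m.+1); last by apply/val_inj; rewrite /= inordK // ltnS.
  rewrite (IH m.+1) ?addSnnS // => /(canRL (subrK _)) ->.
  by rewrite -[m in RHS]/(nat_of_ord (Ordinal mn)) heightS addrC ffunE.
have lastE : a ord_max = closing_height R s.
  have twoN0 : 2 != 0 :> R[i] by rewrite pnatr_eq0.
  have h0 : a ord0 = a ord_max + \sum_k spin R (s k).
    by rewrite (_ : ord0 = inord 0) ?aE //; apply/val_inj; rewrite /= inordK.
  have := anti; rewrite h0 /closing_height => h.
  apply: (mulIf twoN0); rewrite divfK // mulr_natr mulr2n {1}h; ring.
apply/ffunP => i; rewrite ffunE -lastE -aE ?inord_val //; exact: (ltn_ord i).
Qed.

Lemma fsbig_antiperiodic (R : realType) (n : nat) (M : nmodType)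
    (F : {ffun 'I_n.+1 -> R[i]} -> M) :
  \sum_(b \in [set b : {ffun 'I_n.+1 -> R[i]} | antiperiodic b]) F b =
  \sum_(s : {ffun 'I_n -> 'I_2}) F (path_of R s).
Proof.
have -> : [set b : {ffun 'I_n.+1 -> R[i]} | antiperiodic b] =
    [set` [seq path_of R s | s <- index_enum {ffun 'I_n -> 'I_2}]].
  apply/seteqP; split=> b /=.
    by case/antiperiodic_path_of => s ->; apply/mapP; exists s; rewrite ?mem_index_enum.
  by case/mapP => s _ ->; exact: path_of_antiperiodic.
rewrite -fsbig_seq ?big_map // map_inj_uniq ?index_enum_uniq //; exact: path_of_inj.
Qed.

(** * Closing the auxiliary line *)

Lemma sum_pm1 (R : realType) (M : nmodType) (F : R[i] -> M) :
  \sum_(mu <- [:: 1; -1]) F mu = \sum_(p < 2) F (spin R p).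
Proof. by rewrite !big_cons big_nil !big_ord_recl big_ord0. Qed.

(** [K] reverses the auxiliary spin, so the twisted trace pairs the incoming spin
    with the opposite outgoing one. *)
Lemma aux_form_twist (R : realType) (n : nat) (p : 'I_2) (v : aux_tens R n) s :
  aux_form (edual (spin R p)) (aux_mx (Kmx R) v) s = v (rev_ord p, s).
Proof.
rewrite ffunE (bigD1 p) //= big1 ?addr0 => [|p' ne]; last first.
  by rewrite edual_spin (negbTE ne) mul0r.
rewrite edual_spin eqxx mul1r ffunE (bigD1 (rev_ord p)) //= big1 ?addr0 => [|p' ne].
  by rewrite KmxE eqxx mul1r.
by rewrite KmxE (negbTE ne) mul0r.
Qed.

Lemma pure_tens_spin (R : realType) (n : nat) (t s : {ffun 'I_n -> 'I_2})
    (v : 'I_n -> 'cV[R[i]]_2) :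
  (forall i, v i = evec (spin R (t i))) -> pure_tens v s = (s == t)%:R.
Proof.
move=> hv; rewrite ffunE; case: (s =P t) => [->|/eqP ne].
  by rewrite big1 // => i _; rewrite hv evec_spin eqxx.
have [i hi] : exists i, s i != t i.
  by apply/existsP; apply: contraNT ne => /existsPn h; apply/eqP/ffunP => i; apply/eqP/negbNE/h.
by rewrite (bigD1 i) //= hv evec_spin (negbTE hi) mul0r.
Qed.

Lemma ket_path_of (R : realType) (eta d : R[i]) (n : nat) (t s : {ffun 'I_n -> 'I_2}) :
  eta != 0 ->
  ket eta (path_of R t) (- 2 * eta * d) s = (d == closing_height R t)%:R * (s == t)%:R.
Proof.
move=> eta0; have e0 : - 2 * eta != 0 by rewrite mulf_neq0 // oppr_eq0 pnatr_eq0.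
rewrite /ket path_of_last ffunE (@pure_tens_spin _ _ t) => [|i]; last by rewrite path_of_step.
by rewrite /delta (inj_eq (mulfI e0)) eq_sym.
Qed.

(** Exactly one auxiliary spin equals [c - d], unless [c - d] is not a spin, and
    then the weight of the last face vanishes; the latter needs a last site,
    hence [0 < n]. *)
Lemma sum_spin_face (R : realType) (tau eta z c d : R[i]) (n : nat)
    (zs : 'I_n -> R[i]) (t s : {ffun 'I_n -> 'I_2}) : (0 < n)%N ->
  \sum_(p < 2) (spin R p == c - d)%:R * \prod_(k < n) face tau eta t s c d k (z - zs k) =
  \prod_(k < n) face tau eta t s c d k (z - zs k).
Proof.
case: n zs t s => // n zs t s _; rewrite -big_distrl /=.
case: (is_pm1P _ (c - d)) => [[p ->]|/(introN (is_pm1P _ _)) hcd].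
  rewrite (bigD1 p) //= eqxx big1 ?addr0 ?mul1r // => p' ne.
  by rewrite (inj_eq (@spin_inj R)) (negbTE ne).
suff -> : \prod_(k < n.+1) face tau eta t s c d k (z - zs k) = 0 by rewrite mulr0.
apply/eqP/prodf_eq0; exists ord_max => //.
by rewrite /face W_eq0 // !(height_last _ n.+1).
Qed.

Theorem proposition4p1 (R : realType) (tau eta : R[i])
  (htau : 0 < complex.Im tau)
  (heta : forall m k l : int, (2 * m + 1)%:~R * eta <> k%:~R + l%:~R * tau)
  (n : nat) (hn : odd n) (zs : 'I_n -> R[i]) (z : R[i])
  (a : {ffun 'I_n.+1 -> R[i]}) (ha : antiperiodic a) :
  T_IRF tau eta zs z (ket eta a) =
  \sum_(b \in [set b : {ffun 'I_n.+1 -> R[i]} | antiperiodic b])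
    (\prod_(i < n) W tau eta (nxt a i) (cur a i) (cur b i) (nxt b i) (z - zs i))
      *: ket eta b.
Proof.
have eta0 : eta != 0.
  by apply/eqP => e; apply: (heta 0 0 0); rewrite e mulr0 mul0r addr0.
have e0 : - 2 * eta != 0 by rewrite mulf_neq0 // oppr_eq0 pnatr_eq0.
have [t {ha}->] := antiperiodic_path_of _ _ _ ha; rewrite fsbig_antiperiodic fct_sumE.
apply/funext => lambda; apply/ffunP => s.
have [d ->] : exists d, lambda = - 2 * eta * d by exists (lambda / (- 2 * eta)); rewrite mulrC divfK.
have ketZ k b l u : (k *: ket eta b) l u = k * ket eta b l u.
  by rewrite -[LHS]/((k *: ket eta b l) u) ffunE.
set c := closing_height R t.
transitivity ((d == closing_height R s)%:R *
    \prod_(k < n) face tau eta t s c d k (z - zs k)); last first.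
  rewrite sum_ffunE (eq_bigr (fun s' => if s' == s then
    (d == closing_height R s)%:R * \prod_(k < n) face tau eta t s c d k (z - zs k)
    else 0)) => [|s' _]; first by rewrite -big_mkcond big_pred1_eq.
  rewrite ketZ ket_path_of // (eq_sym s).
  case: (s' =P s) => [->|_]; last by rewrite !mulr0.
  rewrite mulr1 mulrC; case: eqP => [->|_]; last by rewrite !mul0r.
  by congr (_ * _); apply: eq_bigr => i _; rewrite !cur_path_of !nxt_path_of.
rewrite /T_IRF sum_pm1 sum_ffunE -(@sum_spin_face _ _ _ _ _ _ _ zs) ?odd_gt0 //.
rewrite big_distrr; apply: eq_bigr => p _ /=.
rewrite aux_form_twist (@Lop_coord _ _ _ _ _ _ c d (spin R p == c - d)%:R t); last first.
  (* [delta] selects the auxiliary spin [c - d]. *)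
  move=> q u; rewrite ffunE /= evec_spin.
  have -> : - 2 * eta * d - 2 * eta * spin R p = - 2 * eta * (spin R p + d) by ring.
  rewrite ket_path_of // -/c (eq_sym _ c) -subr_eq (eq_sym _ (spin R p)).
  case: (spin R p =P c - d) => [<-|_]; last by rewrite !(mulr0, mul0r).
  by rewrite (inj_eq (@spin_inj R)) mul1r mulr1 mulrC.
rewrite spin_rev_ord.
case: (spin R p =P c - d) => [->|_]; last by rewrite !(mulr0, mul0r).
rewrite mul1r mulr1; congr (_%:R * _); congr nat_of_bool.
have two0 : 2 != 0 :> R[i] by rewrite pnatr_eq0.
(* The twist condition is twice the equation [d = closing_height R s]. *)
have full u : \sum_(k < n | (0 <= k)%N) spin R (u k) = \sum_k spin R (u k) by [].
rewrite -subr_eq0 (_ : _ - _ = 2 * (d - closing_height R s)).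
  by rewrite mulf_eq0 (negbTE two0) subr_eq0.
by rewrite /height /c /closing_height !full; field.
Qed.
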